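(* Let $\varphi:\mathbb{R}^n\to\mathbb{R}\cup\{+\infty\}$ be a proper function that is uniformly quasiconvex with modulus $\phi$ on a nonempty closed convex set $C\subseteq\operatorname{dom}\varphi$. (a) If $\overline{x}$ is a stationary point of $\varphi$ on $C$, then $\arg\min_{x\in C}\varphi(x)=\{\overline{x}\}$, i.e., $\overline{x}$ is the unique global minimizer of $\varphi$ on $C$. Moreover, for all $y\in C$, $$\varphi(\overline{x})+\frac14\phi(\|y-\overline{x}\|)\le\varphi(y).$$ (b) If $\varphi$ is lower semicontinuous and coercive, then $\arg\min_{x\in C}\varphi(x)=\{\overline{x}\}$ is a singleton, and $\varphi(\overline{x})+\frac14\phi(\|y-\overline{x}\|)\le\varphi(y)$ for all $y\in C$.
   Context: $\|\cdot\|$ is the Euclidean norm on $\mathbb{R}^n$; $\operatorname{dom}\varphi=\{x:\varphi(x)<+\infty\}$; $\varphi$ is proper if $\operatorname{dom}\varphi\ne\emptyset$, and coercive if $\varphi(x)\to+\infty$ as $\|x\|\to+\infty$. A modulus is an increasing function $\phi:[0,+\infty)\to[0,+\infty]$ (i.e. $s\le t$ implies $\phi(s)\le\phi(t)$) that vanishes only at $0$. The function $\varphi$ is uniformly quasiconvex with modulus $\phi$ on a convex set $C\subseteq\operatorname{dom}\varphi$ if for all $x,y\in C$ and $\lambda\in[0,1]$, $$\varphi(\lambda x+(1-\lambda)y)+\lambda(1-\lambda)\phi(\|x-y\|)\le\max\{\varphi(x),\varphi(y)\}.$$ The Dini lower directional derivative of $\varphi$ at $\overline{x}\in\operatorname{dom}\varphi$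 in direction $d$ is $\varphi^{D-}(\overline{x};d):=\liminf_{t\downarrow0}\frac{\varphi(\overline{x}+td)-\varphi(\overline{x})}{t}$. The cone of feasible directions of the convex set $C$ at $\overline{x}\in C$ is $D_C(\overline{x}):=\{d\in\mathbb{R}^n:\exists\,\delta>0\text{ with }\overline{x}+\lambda d\in C\text{ for all }\lambda\in(0,\delta)\}$. A point $\overline{x}\in\operatorname{dom}\varphi\cap C$ is a stationary point of $\varphi$ on $C$ if $\varphi^{D-}(\overline{x};d)\ge0$ for all $d\in D_C(\overline{x})$. *)

(* Defs.v *)
From mathcomp Require Import all_boot all_order all_algebra.
From mathcomp Require Import all_classical all_reals all_analysis.
Import Order.TTheory GRing.Theory Num.Theory.
Import numFieldNormedType.Exports.

Set Implicit Arguments.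
Unset Strict Implicit.
Unset Printing Implicit Defensive.

Local Open Scope classical_set_scope.
Local Open Scope ring_scope.

(* The canonical norm of 'rV[R]_n in MathComp-Analysis is the sup norm, hence
   this separate definition. Both norms induce the library's topology. *)
Definition enorm (R : realType) (n : nat) (x : 'rV[R]_n) : R :=
  Num.sqrt (\sum_(i < n) x ord0 i ^+ 2).

Definition edom (R : realType) (n : nat) (f : 'rV[R]_n -> \bar R) :
    set 'rV[R]_n :=
  [set x | (f x < +oo)%E].

(* Functions with values in R `|` {+oo} are represented as functions into
   \bar R that never take the value -oo. *)
Definition proper_fun (R : realType) (n : nat) (f : 'rV[R]_n -> \bar R) : Prop :=
  (forall x, (-oo < f x)%E) /\ edom f !=set0.

Definition coercive (R : realType) (n : nat) (f : 'rV[R]_n -> \bar R) : Prop :=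
  forall M : R, exists r : R, forall x, r < enorm x -> (M%:E < f x)%E.

(* A modulus is defined on [0, +oo[ only: the values of phi at negative reals
   are irrelevant. *)
Definition is_modulus (R : realType) (phi : R -> \bar R) : Prop :=
  [/\ forall t : R, 0 <= t -> (0 <= phi t)%E,
      forall s t : R, 0 <= s -> s <= t -> (phi s <= phi t)%E
    & forall t : R, 0 <= t -> (phi t = 0%E <-> t = 0)].

(* When phi takes the value +oo, the products below follow the convention
   0 * +oo = 0 of \bar R. *)
Definition uniformly_quasiconvex (R : realType) (n : nat)
    (f : 'rV[R]_n -> \bar R) (phi : R -> \bar R) (C : set 'rV[R]_n) : Prop :=
  forall (x y : 'rV[R]_n) (l : R), C x -> C y -> 0 <= l -> l <= 1 ->
    (f ((l *: x + (1 - l) *: y)%R) + (l * (1 - l))%:E * phi (enorm (x - y)%R)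
       <= maxe (f x) (f y))%E.

Definition dini_lower (R : realType) (n : nat) (f : 'rV[R]_n -> \bar R)
    (x d : 'rV[R]_n) : \bar R :=
  limf_einf (fun t : R => ((f ((x + t *: d)%R) - f x) * (t^-1)%:E)%E) 0^'+.

Definition feasible_directions (R : realType) (n : nat) (C : set 'rV[R]_n)
    (x : 'rV[R]_n) : set 'rV[R]_n :=
  [set d | exists2 delta : R, 0 < delta &
     forall l : R, 0 < l -> l < delta -> C (x + l *: d)].

Definition stationary_point (R : realType) (n : nat) (f : 'rV[R]_n -> \bar R)
    (C : set 'rV[R]_n) (x : 'rV[R]_n) : Prop :=
  (edom f `&` C) x /\
  forall d, feasible_directions C x d -> (0 <= dini_lower f x d)%E.

Definition argmin (R : realType) (n : nat) (f : 'rV[R]_n -> \bar R)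
    (C : set 'rV[R]_n) : set 'rV[R]_n :=
  [set x | C x /\ forall y, C y -> (f x <= f y)%E].

(* Main.v *)
(** If [x] is stationary and [f y < f x] for some [y] in [C], then uniform
    quasiconvexity on the segment from [x] to [y] bounds the difference quotient
    in direction [y - x] by [- (1 - t) * phi (enorm (y - x))], so its lower limit
    is negative. Hence stationary points are minimizers on [C]. At a minimizer
    [x], uniform quasiconvexity at the midpoint of [x] and [y] gives the growth
    inequality, and with it uniqueness. For (b), a minimizer exists because the
    sublevel sets of [f] in [C] are compact. *)
Require Import Defs.
From mathcomp Require Import all_boot all_order all_algebra.
From mathcomp Require Import finmap lra ring.
From mathcomp Require Import all_classical all_reals all_analysis.
Import Order.TTheory GRing.Theory Num.Theory.
Import numFieldNormedType.Exports.

Local Open Scope classical_set_scope.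
Local Open Scope ring_scope.

Lemma enorm_ge0 (R : realType) (n : nat) (x : 'rV[R]_n) : 0 <= enorm x.
Proof. exact: sqrtr_ge0. Qed.

Lemma norm_coord_le_enorm (R : realType) (n : nat) (x : 'rV[R]_n) (i : 'I_n) :
  `|x ord0 i| <= enorm x.
Proof.
rewrite -sqrtr_sqr /enorm ler_wsqrtr// (bigD1 i)//= lerDl.
by apply: sumr_ge0 => j _; exact: sqr_ge0.
Qed.

(** This one-sided comparison with the sup norm suffices: it makes [enorm] vanish only at 0 and
    turns Euclidean bounds into [bounded_set]. *)
Lemma norm_le_enorm (R : realType) (n : nat) (x : 'rV[R]_n) : `|x| <= enorm x.
Proof.
rewrite [leLHS]mx_normrE; apply/bigmax_leP; split => [|[i j] _ /=].
  exact: enorm_ge0.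
by rewrite ord1 norm_coord_le_enorm.
Qed.

Lemma modulus_enorm_gt0 (R : realType) (n : nat) (phi : R -> \bar R)
    (x y : 'rV[R]_n) :
  is_modulus phi -> x != y -> (0 < phi (enorm (x - y)%R))%E.
Proof.
move=> [phi0 _ phiE] xy; rewrite lt_neqAle phi0 ?enorm_ge0// andbT eq_sym.
apply: contra xy => /eqP /phiE => /(_ (enorm_ge0 _ _ _)) xy0.
by rewrite -subr_eq0 -normr_le0 -xy0 norm_le_enorm.
Qed.

Lemma convex_set_comb {R : realType} {n : nat} {C : set 'rV[R]_n} {x y} {l : R} :
  convex_set C -> C x -> C y -> 0 <= l -> l <= 1 -> C (l *: x + (1 - l) *: y).
Proof.
move=> Cconv Cx Cy l0 l1.
have l01 : Itv.spec (@Itv.num_sem R) (Itv.Real `[0%Z, 1%Z]) l.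
  by rewrite /= /Itv.num_sem/= ger0_real//= in_itv/= l0 l1.
have := Cconv x y (Itv.mk l01).
by rewrite !inE => /(_ Cx Cy).
Qed.

(** Without a minimizer, the open sets [f y < f x] for [y] in [K] cover [K]. In a finite subcover,
    the index with the least value of [f] is a point of [K] left uncovered. *)
Lemma lower_semicontinuous_min (X : ptopologicalType) (R : realType)
    (f : X -> \bar R) (K : set X) :
  lower_semicontinuous f -> compact K -> K !=set0 ->
  exists2 x, K x & forall y, K y -> (f x <= f y)%E.
Proof.
move=> /lower_semicontinuousP f_lsc Kcpt [x0 Kx0]; apply: contrapT => nomin.
have lower x : K x -> exists2 y, K y & (f y < f x)%E.
  move=> Kx; apply: contrapT => nolow; apply: nomin; exists x => // y Ky.
  by rewrite leNgt; apply/negP => fyx; apply: nolow; exists y.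
move: Kcpt; rewrite compact_cover => /(_ X K (fun y => [set x | (f y < f x)%E])).
case=> [y Ky|x Kx|D DK Kcov].
- have [z _] := lower y Ky.
  (* Semicontinuity gives openness for real thresholds only; [+oo] yields the empty set, and [-oo]
     contradicts [f z < f y]. *)
  case: (f y) => [r _| _|]; first exact: f_lsc.
  + rewrite [X in open X](_ : _ = set0); first exact: open0.
    by apply/seteqP; split => // x /=; rewrite ltNge leey.
  + by rewrite ltNge leNye.
- by have [y Ky fyx] := lower x Kx; exists y.
have [d0 d0D _] := Kcov _ Kx0.
case: (arg_minP (fun i : D => f (val i)) (i0 := [` d0D]%fset) (P := xpredT)) => // m _ m_min.
have [d dD] := Kcov (val m) (set_mem (DK _ (valP m))).
by rewrite /= ltNge (m_min [` dD]%fset).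
Qed.

Lemma argmin_growth (R : realType) (n : nat) (f : 'rV[R]_n -> \bar R)
    (phi : R -> \bar R) (C : set 'rV[R]_n) (x y : 'rV[R]_n) :
  convex_set C -> uniformly_quasiconvex f phi C -> argmin f C x -> C y ->
  (f x + (4^-1)%:E * phi (enorm (y - x)%R) <= f y)%E.
Proof.
move=> Cconv f_uqc [Cx xmin] Cy.
have h0 : 0 <= 2^-1 :> R by rewrite invr_ge0.
have h1 : 2^-1 <= 1 :> R by rewrite invf_le1// ler1n.
have := f_uqc y x 2^-1 Cy Cx h0 h1.
rewrite (max_l (xmin _ Cy)) (_ : 2^-1 * (1 - 2^-1) = 4^-1 :> R); last by field.
by apply: le_trans; rewrite leeD2r// xmin//; exact: convex_set_comb.
Qed.

Lemma argmin_set1 (R : realType) (n : nat) (f : 'rV[R]_n -> \bar R)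
    (phi : R -> \bar R) (C : set 'rV[R]_n) (x : 'rV[R]_n) :
  is_modulus phi -> convex_set C -> uniformly_quasiconvex f phi C ->
  f x \is a fin_num -> argmin f C x -> argmin f C = [set x].
Proof.
move=> phi_mod Cconv f_uqc fx xmin; apply/seteqP; split => [y [Cy ymin]|_ ->//].
apply/eqP/negP => /negP yx.
have := argmin_growth _ _ _ _ _ _ _ Cconv f_uqc xmin Cy.
(* Two distinct minimizers would give [f x + phi(...) / 4 <= f x]; cancelling [f x] uses its
   finiteness. *)
move=> /le_trans/(_ (ymin _ xmin.1)); apply/negP; rewrite -ltNge lteDl//.
by rewrite mule_gt0 ?lte_fin ?invr_gt0//; exact: modulus_enorm_gt0.
Qed.

(** The lower limit is the supremum over [V] in [F] of the infimum of [g] on [V], and each such [V]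
    meets the set where [g t <= c] because [F] is proper. *)
Lemma limf_einf_le (T : choiceType) (X : filteredType T) (R : realType)
    (F : set_system X) {FF : ProperFilter F} (g : X -> \bar R) (c : \bar R) :
  (\forall t \near F, (g t <= c)%E) -> (limf_einf g F <= c)%E.
Proof.
move=> gc; rewrite limf_einfE; apply: ge_ereal_sup => _ [V FV <-].
have [t [Vt gtc]] : exists t, V t /\ (g t <= c)%E.
  exact: (filter_ex (filterI FV gc)).
by apply: le_trans gtc; apply: ereal_inf_lbound; exists t.
Qed.

(** Here [a] may be [+oo], as [phi] may be; then [u] must be [-oo], which absorbs [+oo] in sums. *)
Lemma leeBN_of_leeD (R : realDomainType) (u a z : \bar R) :
  z \is a fin_num -> (u + a <= z -> u - z <= - a)%E.
Proof.
case: z u a => [z| |]// [u| |] [a| |]//= _; rewrite ?leey ?leNye//.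
by rewrite !lee_fin => ?; lra.
Qed.

Lemma stationary_argmin (R : realType) (n : nat) (f : 'rV[R]_n -> \bar R)
    (phi : R -> \bar R) (C : set 'rV[R]_n) (x : 'rV[R]_n) :
  is_modulus phi -> convex_set C -> uniformly_quasiconvex f phi C ->
  f x \is a fin_num -> stationary_point f C x -> argmin f C x.
Proof.
move=> phi_mod Cconv f_uqc fx [[_ Cx] f_stat]; split => // y Cy.
rewrite leNgt; apply/negP => fyx.
have yx : y != x by apply: contraTneq fyx => ->; rewrite ltxx.
have combE (t : R) : x + t *: (y - x) = t *: y + (1 - t) *: x.
  by rewrite scalerBr scalerBl scale1r addrCA addrA.
have feas : feasible_directions C x (y - x).
  exists 1 => // t t0 t1.
  by rewrite combE; apply: convex_set_comb => //; exact: ltW.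
have phi_gt0 := modulus_enorm_gt0 _ _ _ _ _ phi_mod yx.
have := f_stat _ feas; apply/negP; rewrite -ltNge.
(* For [t < 1/2] the factor [1 - t] exceeds [1/2], so this negative bound on the quotients does not
   depend on [t]. *)
apply: (@le_lt_trans _ _ (- ((2^-1)%:E * phi (enorm (y - x)%R)))%E); last first.
  by rewrite oppe_lt0 mule_gt0// lte_fin invr_gt0.
apply: limf_einf_le; near=> t.
have t0 : 0 < t by near: t; exact: nbhs_right_gt.
have t2 : t < 2^-1 by near: t; apply: nbhs_right_lt; rewrite invr_gt0.
have t1 : t <= 1 by lra.
have := f_uqc y x t Cy Cx (ltW t0) t1.
rewrite -combE (max_r (ltW fyx)) => f_le.
apply: (@le_trans _ _ (- ((t * (1 - t))%:E * phi (enorm (y - x)%R)) * (t^-1)%:E)%E).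
  rewrite lee_wpmul2r ?lee_fin ?invr_ge0 ?(ltW t0)//.
  exact: leeBN_of_leeD.
rewrite mulNe leeN2 muleAC -EFinM lee_wpmul2r ?(ltW phi_gt0)// lee_fin.
by rewrite mulrAC mulfV ?gt_eqF// mul1r; lra.
Unshelve. all: by end_near.
Qed.

Theorem theorem3p23 (R : realType) (n : nat) (f : 'rV[R]_n -> \bar R)
    (phi : R -> \bar R) (C : set 'rV[R]_n)
    (f_proper : proper_fun f) (phi_modulus : is_modulus phi)
    (C_nonempty : C !=set0) (C_closed : closed C) (C_convex : convex_set C)
    (C_dom : C `<=` edom f) (f_uqc : uniformly_quasiconvex f phi C) :
  (forall xbar : 'rV[R]_n, stationary_point f C xbar ->
     argmin f C = [set xbar] /\
     (forall y, C y ->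
        (f xbar + (4^-1)%:E * phi (enorm (y - xbar)%R) <= f y)%E)) /\
  (lower_semicontinuous f -> coercive f ->
     exists xbar : 'rV[R]_n,
       argmin f C = [set xbar] /\
       (forall y, C y ->
          (f xbar + (4^-1)%:E * phi (enorm (y - xbar)%R) <= f y)%E)).
Proof.
have f_fin x : C x -> f x \is a fin_num.
  by move=> /C_dom fx; rewrite fin_numElt f_proper.1 fx.
split => [x x_stat|f_lsc f_coercive].
  have fx := f_fin _ x_stat.1.2.
  have xmin : argmin f C x by exact: stationary_argmin f_uqc fx x_stat.
  split; first exact: argmin_set1 f_uqc fx xmin.
  by move=> y; exact: argmin_growth f_uqc xmin.
have [x0 Cx0] := C_nonempty.
(* Beyond radius [r], [f] exceeds [f x0], so the sublevel set [K] is bounded. *)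
have [r r_lower] := f_coercive (fine (f x0)).
pose K := C `&` [set x | (f x <= f x0)%E].
have Kclosed : closed K.
  apply: closedI => //; rewrite -(setCK (mkset _)) closedC.
  move/lower_semicontinuousP : f_lsc => /(_ (fine (f x0))).
  rewrite fineK ?f_fin//; congr open; apply/seteqP; split => x /=;
    by rewrite ltNge => /negP.
have Kbounded : bounded_set K.
  exists r; split; first exact: num_real.
  move=> M rM x [Cx fx]; apply: le_trans (norm_le_enorm _ _ _) _.
  rewrite leNgt; apply/negP => Mx.
  have := r_lower _ (lt_trans rM Mx).
  by rewrite fineK ?f_fin// ltNge fx.
have [|x [Cx fxx0] xminK] := lower_semicontinuous_min _ _ _ _ f_lsc
  (bounded_closed_compact Kbounded Kclosed).
  by exists x0; split => /=.
have xmin : argmin f C x.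
  (* Points of [C] outside [K] have values above [f x0], hence above [f x]. *)
  split => // y Cy; have [fy|/ltW fy] := leP (f y) (f x0); first exact: xminK.
  exact: le_trans fy.
exists x; split; first exact: argmin_set1 f_uqc (f_fin _ Cx) xmin.
by move=> y; exact: argmin_growth f_uqc xmin.
Qed.
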